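(* Let $M$ be a smooth manifold, $\tau\in\Omega^1(M)$, $\omega\in\Omega^2(M)$, let $B=\tau\otimes\tau+\omega$ and let $\widehat B\colon TM\to T^*M$, $\widehat B(v)=(\iota_v\tau)\,\tau+\iota_v\omega$. Then $$\mathcal K_{(\tau,\omega)}=\operatorname{Ker}\tau\cap\operatorname{Ker}\omega=\operatorname{Ker}\widehat B=(\operatorname{Im}\widehat B)^\circ$$ holds at every point. Thus $$\mathcal K_{(\tau,\omega)}^\circ=(\operatorname{Ker}\widehat B)^\circ=\operatorname{Im}\widehat B,$$ and, hence, the class of the pair is (at every point) equal to the dimension of $\operatorname{Im}\widehat B$.
   Context: For a $p$-form $\alpha$, $\operatorname{Ker}\alpha_x=\{v\in T_xM\mid\iota_v\alpha_x=0\}$. The characteristic distribution of $(\tau,\omega)$ at $x$ is $\mathcal K_{(\tau,\omega)_x}=\operatorname{Ker}\tau_x\cap\operatorname{Ker}\omega_x$, and the class of the pair at $x$ is its codimension in $T_xM$. The symbol $^\circ$ denotes the annihilator: of a subspace of $T_xM$ inside $T_x^*M$, or of a subspace of $T_x^*M$ inside $T_xM$. *)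

(* Defs.v *)
From HB Require Import structures.
From mathcomp Require Import all_boot all_order all_algebra.
From mathcomp Require Import all_classical all_reals all_analysis.
Set Implicit Arguments.
Unset Strict Implicit.
Unset Printing Implicit Defensive.
Import Order.TTheory GRing.Theory Num.Theory.
Import numFieldNormedType.Exports.
Local Open Scope classical_set_scope.
Local Open Scope ring_scope.

Section Annihilators.
Variables (R : fieldType) (V : vectType R).

Notation dual := 'Hom(V, R^o).

Definition eval_at (u : V) (f : dual) : R^o := f u.

Fact eval_at_is_linear u : linear (eval_at u).
Proof. by move=> a f g; rewrite /eval_at add_lfunE scale_lfunE. Qed.

HB.instance Definition _ u :=
  GRing.isLinear.Build R dual R^o *:%R (eval_at u) (eval_at_is_linear u).

Definition annihilator (U : {vspace V}) : {vspace dual} :=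
  (\bigcap_(i < \dim U) lker (linfun (eval_at (vbasis U)`_i)))%VS.

Lemma annihilatorP (U : {vspace V}) (f : dual) :
  reflect (forall u, u \in U -> f u = 0) (f \in annihilator U).
Proof.
rewrite memvE; apply: (iffP subv_bigcapP) => [h u uU|h i _].
  rewrite (coord_vbasis uU) linear_sum big1 // => i _.
  have := h i isT; rewrite -memvE memv_ker lfunE /= => /eqP fi0.
  by rewrite linearZ /= [f _]fi0 scaler0.
rewrite -memvE memv_ker lfunE /=; apply/eqP/h.
by apply: vbasis_mem; rewrite mem_nth // size_tuple.
Qed.

Definition coannihilator (W : {vspace dual}) : {vspace V} :=
  (\bigcap_(i < \dim W) lker (vbasis W)`_i)%VS.

Lemma coannihilatorP (W : {vspace dual}) (v : V) :
  reflect (forall f, f \in W -> f v = 0) (v \in coannihilator W).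
Proof.
rewrite memvE; apply: (iffP subv_bigcapP) => [h f fW|h i _].
  rewrite (coord_vbasis fW) sum_lfunE big1 // => i _.
  have := h i isT; rewrite -memvE memv_ker => /eqP fi0.
  by rewrite scale_lfunE fi0 scaler0.
rewrite -memvE memv_ker; apply/eqP/h.
by apply: vbasis_mem; rewrite mem_nth // size_tuple.
Qed.

End Annihilators.

Section Smoothness.
Variables (R : realType) (V W : normedModType R).

(* For [U] open: [f] is of class C^k on [U]. *)
Fixpoint Ck_on (k : nat) (U : set V) (f : V -> W) : Prop :=
  if k is k'.+1 then
    (forall x, U x -> differentiable f x) /\
    (forall v, Ck_on k' U (fun x => 'd f x v))
  else forall x, U x -> {for x, continuous f}.

Definition smooth_on (U : set V) (f : V -> W) : Prop :=
  forall k, Ck_on k U f.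

End Smoothness.

Lemma diff_derive_comp (R : realType) (U V W : normedModType R)
    (f : U -> V) (g : V -> W) (x w : U) (y : V) :
  differentiable f x -> differentiable g y -> f x = y ->
  'd g y ('d f x w) = 'D_w (g \o f) x.
Proof.
move=> df dg e; move: dg; rewrite -e => dg.
rewrite (deriveE _ (differentiable_comp df dg)).
exact: (esym (congr1 (fun h : U -> W => h w) (diff_comp df dg))).
Qed.

(* [chart_map] and [chart_inv] are total functions, but only their values on
   [chart_dom] and on [chart_cod] are meaningful. *)
Record chart (R : realType) (n : nat) (M : topologicalType) := Chart {
  chart_dom : set M;
  chart_map :> M -> 'rV[R]_n;
  chart_inv : 'rV[R]_n -> M;
  chart_cod := chart_map @` chart_dom;
  chart_dom_open : open chart_dom;
  chart_cod_open : open chart_cod;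
  chart_mapK : forall x, chart_dom x -> chart_inv (chart_map x) = x;
  chart_map_continuous : forall x, chart_dom x -> {for x, continuous chart_map};
  chart_inv_continuous : forall y, chart_cod y -> {for y, continuous chart_inv} }.

Definition transition (R : realType) (n : nat) (M : topologicalType)
  (c c' : chart R n M) : 'rV[R]_n -> 'rV[R]_n := c' \o chart_inv c.

Record smoothManifold (R : realType) (n : nat) := SmoothManifold {
  carrier :> topologicalType;
  atlas : set (chart R n carrier);
  manifold_hausdorff : hausdorff_space carrier;
  manifold_second_countable : @second_countable carrier;
  atlas_cover : forall x, exists2 c, atlas c & chart_dom c x;
  atlas_smooth : forall c c', atlas c -> atlas c' ->
    smooth_on (c @` (chart_dom c `&` chart_dom c')) (transition c c') }.

Definition chart_at (R : realType) (n : nat) (M : smoothManifold R n) (x : M) :=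
  {c : chart R n M | atlas c /\ chart_dom c x}.

Section TangentSpace.
Variables (R : realType) (n : nat) (M : smoothManifold R n) (x : M).
Implicit Types c : chart_at x.

Definition transition_diff c c' (w : 'rV[R]_n) : 'rV[R]_n :=
  'd (transition (sval c) (sval c')) (sval c x) w.

(* A tangent vector is the family of its components in all the charts of the
   atlas around [x], transforming by the differentials of the transitions. *)
Definition coherent : {pred chart_at x -> 'rV[R]_n} :=
  fun v => `[< forall c c', v c' = transition_diff c c' (v c) >].

Record tangent := Tangent {
  components :> chart_at x -> 'rV[R]_n;
  _ : components \in coherent }.

HB.instance Definition _ := [isSub for components].
HB.instance Definition _ := [Choice of tangent by <:].

Fact coherent_submod : submod_closed coherent.
Proof.
split=> [|a u v /asboolP uC /asboolP vC]; apply/asboolP => c c'.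
  by rewrite /transition_diff linear0.
rewrite /transition_diff linearP /=.
by congr (_ *: _ + _); [exact: uC | exact: vC].
Qed.

HB.instance Definition _ :=
  GRing.isSubmodClosed.Build R (chart_at x -> 'rV[R]_n) coherent coherent_submod.
HB.instance Definition _ := [SubChoice_isSubLmodule of tangent by <:].

Lemma transition_differentiable c c' :
  differentiable (transition (sval c) (sval c')) (sval c x).
Proof.
case: c c' => [c [ac cx]] [c' [ac' c'x]] /=.
by have [+ _] := atlas_smooth ac ac' 1; apply; exists x.
Qed.

Lemma transition_diff_comp c c' c'' (w : 'rV[R]_n) :
  transition_diff c' c'' (transition_diff c c' w) = transition_diff c c'' w.
Proof.
have d1 := transition_differentiable c c'.
have d2 := transition_differentiable c' c''.
have d3 := transition_differentiable c c''.
have e : transition (sval c) (sval c') (sval c x) = sval c' x.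
  by rewrite /transition /= chart_mapK //; case: (svalP c).
have dg : 'D_w (transition (sval c') (sval c'') \o
                transition (sval c) (sval c')) (sval c x) =
          'D_w (transition (sval c) (sval c'')) (sval c x).
  apply: near_eq_derive.
  have nx : nbhs x (chart_dom (sval c')).
    by apply: open_nbhs_nbhs; split;
      [exact: chart_dom_open | case: (svalP c')].
  have [_ cx] := svalP c.
  have : chart_inv (sval c) @ (sval c x) --> chart_inv (sval c) (sval c x).
    by apply: chart_inv_continuous; exists x.
  rewrite (chart_mapK cx) => /(_ _ nx) h.
  have {}h : \forall y \near sval c x,
      chart_dom (sval c') (chart_inv (sval c) y) by exact: h.
  by near=> y; rewrite /transition /= chart_mapK //; near: y.
exact: etrans (diff_derive_comp w d1 d2 e) (etrans dg (deriveE w d3)).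
Unshelve. all: by end_near. Qed.

Lemma transition_diff_id c (w : 'rV[R]_n) : transition_diff c c w = w.
Proof.
have d := transition_differentiable c c.
apply: etrans (esym (deriveE _ d)) _.
have -> : 'D_w (transition (sval c) (sval c)) (sval c x) =
          'D_w (@id 'rV[R]_n) (sval c x).
  apply: near_eq_derive.
  have [_ cx] := svalP c.
  have nx : nbhs (sval c x) (chart_cod (sval c)).
    by apply: open_nbhs_nbhs; split; [exact: chart_cod_open | exists x].
  by apply: filterS nx => _ [y cy <-]; rewrite /transition /= chart_mapK.
by rewrite derive_id.
Qed.

Fact chart_vector_coherent c (w : 'rV[R]_n) :
  (fun c' => transition_diff c c' w) \in coherent.
Proof. by apply/asboolP => c' c''; rewrite transition_diff_comp. Qed.

(* [chart_vector c w] is the vector with components [w] in the chart [c], that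
   is, \sum_i w_i d/dx^i. *)
Definition chart_vector c (w : 'rV[R]_n) : tangent :=
  Tangent (chart_vector_coherent c w).

Lemma chart_vectorE c (w : 'rV[R]_n) : chart_vector c w c = w.
Proof. exact: transition_diff_id. Qed.

Lemma chart_vectorK c (v : tangent) : chart_vector c (v c) = v.
Proof.
apply/val_inj/funext => c' /=.
by case: v => v /= /asboolP /(_ c c').
Qed.

Fact tangent_finDim : Vector.axiom n tangent.
Proof.
have [c0 ac0 c0x] := cid2 (atlas_cover x).
pose c : chart_at x := exist _ c0 (conj ac0 c0x).
exists (fun v : tangent => v c) => [a u v //|].
by exists (chart_vector c) => [v|w]; [exact: chart_vectorK|exact: chart_vectorE].
Qed.

HB.instance Definition _ := Lmodule_hasFinDim.Build R tangent tangent_finDim.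

Definition cotangent := 'Hom(tangent, R^o).

End TangentSpace.

Arguments tangent {R n M} x.

(* A bilinear form [b] on the tangent space is encoded by the linear map sending
   [v] to [b(v, -)], so that application is the interior product, and [lker]
   is Ker, both for 1-forms and for 2-forms. *)
Record oneForm (R : realType) (n : nat) (M : smoothManifold R n) := OneForm {
  one_form_at :> forall x : M, 'Hom(tangent x, R^o);
  one_form_smooth : forall (c : chart R n M) (ac : atlas c) (w : 'rV[R]_n),
    exists2 g : 'rV[R]_n -> R^o, smooth_on (chart_cod c) g &
      forall (x : M) (cx : chart_dom c x),
        one_form_at x (chart_vector (exist _ c (conj ac cx)) w) = g (c x) }.

Record twoForm (R : realType) (n : nat) (M : smoothManifold R n) := TwoForm {
  two_form_at :> forall x : M, 'Hom(tangent x, 'Hom(tangent x, R^o));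
  two_form_alternating : forall (x : M) (v : tangent x), two_form_at x v v = 0;
  two_form_smooth : forall (c : chart R n M) (ac : atlas c) (w w' : 'rV[R]_n),
    exists2 g : 'rV[R]_n -> R^o, smooth_on (chart_cod c) g &
      forall (x : M) (cx : chart_dom c x),
        let e := chart_vector (exist _ c (conj ac cx)) in
        two_form_at x (e w) (e w') = g (c x) }.

Section Pair.
Variables (R : realType) (n : nat) (M : smoothManifold R n).
Variables (tau : oneForm M) (omega : twoForm M) (x : M).

Definition charDistribution : {vspace tangent x} :=
  (lker (tau x) :&: lker (omega x))%VS.

Definition pairClass : nat :=
  (\dim {: tangent x} - \dim charDistribution)%N.

(* The bilinear form tau (x) tau + omega. *)
Definition Bform (v w : tangent x) : R := tau x v * tau x w + omega x v w.

Definition hatB_fun (v : tangent x) : 'Hom(tangent x, R^o) :=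
  tau x v *: tau x + omega x v.

Fact hatB_is_linear : linear hatB_fun.
Proof.
move=> a u v; rewrite /hatB_fun (linearP (tau x)) (linearP (omega x)) scalerDl.
by rewrite scalerDr scalerA addrACA.
Qed.

HB.instance Definition _ :=
  GRing.isLinear.Build R (tangent x) 'Hom(tangent x, R^o) *:%R hatB_fun
    hatB_is_linear.

Definition hatB : 'Hom(tangent x, 'Hom(tangent x, R^o)) := linfun hatB_fun.

Lemma hatBE v : hatB v = tau x v *: tau x + omega x v.
Proof. by rewrite lfunE. Qed.

Lemma hatB_Bform v w : hatB v w = Bform v w.
Proof. by rewrite hatBE add_lfunE scale_lfunE. Qed.

End Pair.

(* Main.v *)
Require Import Defs.
From HB Require Import structures.
From mathcomp Require Import all_boot all_order all_algebra.
From mathcomp Require Import all_classical all_reals all_analysis.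

(** At a point, write [B(u, v) = tau(u) tau(v) + omega(u, v)]. Since [omega] is
    alternating, [B(v, v) = tau(v)^2], so a vector [v] in either the left or the
    right radical of [B] satisfies [tau(v) = 0]; what remains of the condition is
    [omega(v, -) = 0], respectively [omega(-, v) = 0], and these agree by skew
    symmetry. Thus both radicals equal the common kernel of [tau] and [omega]
    ([hatB_ker_cap], [hatB_ker_coannihilator]). The left radical is the kernel
    of the map [hatB], the right one is the annihilator of its image, so the
    remaining equality of subspaces is the double annihilator theorem in finite
    dimension ([coannihilatorK]), and the formula for the class is
    rank-nullity. *)

Import GRing.Theory.
Local Open Scope ring_scope.

(** If [f] vanishes wherever the basis functionals [f_i] of [W] all vanish, then
    [f] factors through the map [F : v |-> (f_i(v))_i], as [f = g F] with
    [g = f F^-1] for any pseudo-inverse [F^-1]. Expanding [F(v)] in the standard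
    basis shows that [f] is the combination of the [f_i] with coefficients
    [g(e_i)]. *)
Lemma coannihilatorK {R : fieldType} {V : vectType R}
    (W : {vspace 'Hom(V, R^o)}) :
  annihilator (coannihilator W) = W.
Proof.
apply/vspaceP => f; apply/annihilatorP/idP => [fW0|fW]; last first.
  by move=> v /coannihilatorP; apply.
pose F0 (v : V) : 'rV[R]_(\dim W) := \row_i (vbasis W)`_i v.
have F0lin : linear F0.
  by move=> a u v; apply/rowP => i; rewrite !mxE linearP.
pose F0isL := GRing.isLinear.Build R V 'rV[R]_(\dim W) *:%R F0 F0lin.
pose F0L : {linear V -> 'rV[R]_(\dim W)} := HB.pack F0 F0isL.
pose F := linfun F0L.
have FE v i : F v 0 i = (vbasis W)`_i v by rewrite lfunE /= mxE.
have fFE v : f v = f (F^-1%VF (F v)).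
  apply/eqP; rewrite -subr_eq0 -linearB; apply/eqP/fW0.
  have FK : F (v - F^-1%VF (F v)) = 0.
    by rewrite linearB /= limg_lfunVK ?subrr ?memv_img ?memvf.
  apply/coannihilatorP => g gW.
  rewrite (coord_vbasis gW) sum_lfunE big1 // => i _.
  by rewrite scale_lfunE -FE FK mxE scaler0.
have -> : f = \sum_i f (F^-1%VF (delta_mx 0 i)) *: (vbasis W)`_i.
  apply/lfunP => v; rewrite fFE [F v]row_sum_delta !linear_sum sum_lfunE /=.
  by apply: eq_bigr => i _; rewrite FE !linearZ scale_lfunE; exact: mulrC.
apply: memv_suml => i _; apply: memvZ.
by apply: vbasis_mem; rewrite mem_nth // size_tuple.
Qed.

Section Radicals.
Variables (R : realType) (n : nat) (M : smoothManifold R n).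
Variables (tau : oneForm M) (omega : twoForm M) (x : M).
Implicit Types u v : tangent x.

Lemma two_form_skew u v : omega x u v = - omega x v u.
Proof.
have := two_form_alternating omega (u + v).
rewrite (linearD (omega x)) add_lfunE !linearD /= !two_form_alternating.
by rewrite add0r addr0 => /eqP; rewrite addr_eq0 => /eqP.
Qed.

(** The restriction of the form to the diagonal is [tau(v)^2], because the
    alternating part drops out. *)
Lemma hatB_diag_eq0 v : hatB tau omega x v v = 0 -> tau x v = 0.
Proof.
rewrite hatB_Bform /Bform two_form_alternating addr0 => /eqP.
by rewrite mulf_eq0 orbb => /eqP.
Qed.

Lemma hatB_ker_cap :
  (lker (tau x) :&: lker (omega x))%VS = lker (hatB tau omega x).
Proof.
apply/vspaceP => v; rewrite memv_cap !memv_ker; apply/andP/eqP => [[]|Bv].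
  by move=> /eqP tv /eqP ov; rewrite hatBE tv ov scale0r addr0.
have tv : tau x v = 0 by apply: hatB_diag_eq0; rewrite Bv zero_lfunE.
by rewrite tv eqxx; split=> //; rewrite -Bv hatBE tv scale0r add0r.
Qed.

(** The annihilator of the image is the right radical; it coincides with the
    left one although the form is in general neither symmetric nor skew. *)
Lemma hatB_ker_coannihilator :
  lker (hatB tau omega x) = coannihilator (limg (hatB tau omega x)).
Proof.
rewrite -hatB_ker_cap; apply/vspaceP => v; rewrite memv_cap !memv_ker.
apply/andP/coannihilatorP => [[/eqP tv /eqP ov] _ /memv_imgP[u _ ->]|Bv].
  by rewrite hatB_Bform /Bform tv mulr0 two_form_skew ov zero_lfunE oppr0 addr0.
have Buv u : hatB tau omega x u v = 0 by apply/Bv/memv_img/memvf.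
have tv := hatB_diag_eq0 v (Buv v).
rewrite tv eqxx; split=> //; apply/eqP/lfunP => u.
have := Buv u; rewrite hatB_Bform /Bform tv mulr0 add0r => ouv.
by rewrite two_form_skew ouv oppr0 zero_lfunE.
Qed.

End Radicals.

Theorem proposition3p2 (R : realType) (n : nat) (M : smoothManifold R n)
    (tau : oneForm M) (omega : twoForm M) (x : M) :
  [/\ charDistribution tau omega x = (lker (tau x) :&: lker (omega x))%VS,
      (lker (tau x) :&: lker (omega x))%VS = lker (hatB tau omega x) &
      lker (hatB tau omega x) = coannihilator (limg (hatB tau omega x))] /\
  [/\ annihilator (charDistribution tau omega x)
        = annihilator (lker (hatB tau omega x)),
      annihilator (lker (hatB tau omega x)) = limg (hatB tau omega x) &
      pairClass tau omega x = \dim (limg (hatB tau omega x))].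
Proof.
have kerE : charDistribution tau omega x = lker (hatB tau omega x).
  exact: hatB_ker_cap.
split; split=> //.
- exact: hatB_ker_coannihilator.
- by rewrite kerE.
- by rewrite hatB_ker_coannihilator coannihilatorK.
- by rewrite /pairClass kerE -(limg_ker_dim (hatB tau omega x)) capfv addKn.
Qed.
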